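(* For all states $i,s$ of an LTS with inputs and outputs, $i\mathrel{\mathsf{iocos}} s$ holds if and only if for every formula $\phi\in\widetilde{\mathcal L}_{\mathsf{iocos}}$, $s\models\phi$ implies $i\models\phi$.
   Context: Fix disjoint finite sets $I$ of input actions (written $a?,b?,\dots$) and $O$ of output actions (written $a!,b!,\dots$), where $O$ contains a distinguished quiescence action $\delta!$; let $L=I\cup O$. An LTS with inputs and outputs is a tuple $(S,I,O,\to)$ with $\to\subseteq S\times L\times S$, such that $p\xrightarrow{\delta!}p'$ iff $p=p'$ and $p$ has no $a!$-transition for any $a!\in O\setminus\{\delta!\}$. LTSs are image-finite (finitely many $a$-successors of each state for each $a$). Let $\mathsf{ins}(p)=\{a?\in I\mid p \text{ has an } a?\text{-transition}\}$. A relation $R\subseteq S\times S$ is an iocos-relation if for every $(p,q)\in R$: (1) $\mathsf{ins}(q)\subseteq\mathsf{ins}(p)$; (2) for every $a?\in\mathsf{ins}(q)$ and $p\xrightarrow{a?}p'$ there is $q\xrightarrow{a?}q'$ with $(p',q')\in R$; (3) for every $a!\in O$ and $p\xrightarrow{a!}p'$ there is $q\xrightarrow{a!}q'$ with $(p',q')\in R$. $\mathsf{iocos}$ is the union of all iocos-relations. The logic $\widetilde{\mathcal L}_{\mathsf{iocos}}$ has formulae $\phi::=\mathrm{tt}\mid\mathrm{ff}\mid\phi\wedge\phi\mid\phi\vee\phi\mid[\![a?]\!]\phi\mid[a!]\phi$ with $a?\in I$, $a!\in O$; Boolean constructs as usual, $p\models[a!]\phi$ iff $p'\models\phi$ for every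 $p'$ with $p\xrightarrow{a!}p'$, and $p\models[\![a?]\!]\phi$ iff $p$ has at least one $a?$-transition and $p'\models\phi$ for every $p'$ with $p\xrightarrow{a?}p'$. *)

(* Defs.v *)
From mathcomp Require Import all_boot.
From mathcomp Require Import classical_sets cardinality.

Set Implicit Arguments.
Unset Strict Implicit.
Unset Printing Implicit Defensive.

Local Open Scope classical_set_scope.

(* The label set is the disjoint union I + O: the input a? is inl a and the
   output a! is inr a. The element delta of O is quiescence. *)
Record lts (I O : finType) (delta : O) := LTS {
  state :> Type;
  trans : state -> I + O -> state -> Prop;
  quiescence : forall p p' : state,
    trans p (inr delta) p' <->
    p = p' /\ forall a : O, a <> delta -> ~ exists q, trans p (inr a) q;
  image_finite : forall (p : state) (l : I + O),
    finite_set [set q | trans p l q]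
}.

Arguments trans {I O delta M} p l p' : rename.

Definition ins (I O : finType) (delta : O) (M : lts I delta) (p : M) : set I :=
  [set a | exists p', trans p (inl a) p'].

Definition iocos_relation (I O : finType) (delta : O) (M : lts I delta)
    (R : M -> M -> Prop) : Prop :=
  forall p q : M, R p q ->
  [/\ ins q `<=` ins p,
      forall (a : I) (p' : M), ins q a -> trans p (inl a) p' ->
        exists2 q', trans q (inl a) q' & R p' q'
    & forall (a : O) (p' : M), trans p (inr a) p' ->
        exists2 q', trans q (inr a) q' & R p' q'].

Definition iocos (I O : finType) (delta : O) (M : lts I delta) (p q : M) : Prop :=
  exists2 R : M -> M -> Prop, iocos_relation R & R p q.

Inductive formula (I O : Type) : Type :=
| FTrue
| FFalse
| FAnd (phi psi : formula I O)
| FOr (phi psi : formula I O)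
| FBoxIn (a : I) (phi : formula I O)    (* [[a?]] phi *)
| FBoxOut (a : O) (phi : formula I O).  (* [a!] phi *)

Fixpoint sat (I O : finType) (delta : O) (M : lts I delta) (p : M)
    (phi : formula I O) : Prop :=
  match phi with
  | FTrue => True
  | FFalse => False
  | FAnd phi1 phi2 => sat p phi1 /\ sat p phi2
  | FOr phi1 phi2 => sat p phi1 \/ sat p phi2
  | FBoxIn a phi1 =>
      (exists p' : M, trans p (inl a) p') /\
      forall p' : M, trans p (inl a) p' -> sat p' phi1
  | FBoxOut a phi1 => forall p' : M, trans p (inr a) p' -> sat p' phi1
  end.

(* Main.v *)
Require Import Defs.
From mathcomp Require Import all_boot.
From mathcomp Require Import boolp classical_sets cardinality.

Local Open Scope classical_set_scope.

(** A Hennessy-Milner argument. The only modalities are boxes, so truth travels backwards along a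
    simulation: [iocos_sat], by induction on the formula. Conversely, inclusion of satisfied
    formulas is itself an iocos-relation ([sat_le_iocos_relation]), where [finite_set_sat_le] finds
    the matching successor. *)

Lemma iocos_sat (I O : finType) (delta : O) (M : lts I delta) (p q : M)
    (phi : formula I O) :
  iocos p q -> sat q phi -> sat p phi.
Proof.
case=> R simR; elim: phi p q => //=.
- by move=> phi IHphi psi IHpsi p q Rpq [/(IHphi _ _ Rpq) ? /(IHpsi _ _ Rpq)].
- move=> phi IHphi psi IHpsi p q Rpq.
  by case=> [/(IHphi _ _ Rpq)|/(IHpsi _ _ Rpq)]; [left|right].
- move=> a phi IHphi p q Rpq [q_a q_phi].
  have [ins_qp sim_in _] := simR _ _ Rpq.
  split=> [|p' pp']; first exact: ins_qp.
  have [q' qq' Rpq'] := sim_in _ _ q_a pp'.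
  exact: IHphi Rpq' (q_phi _ qq').
- move=> a phi IHphi p q Rpq q_phi p' pp'.
  have [_ _ sim_out] := simR _ _ Rpq.
  have [q' qq' Rpq'] := sim_out _ _ pp'.
  exact: IHphi Rpq' (q_phi _ qq').
Qed.

(* Image-finiteness enters here: the separating formula is the disjunction of
   the formulas that separate each element of A from p. *)
Lemma finite_set_sat_le (I O : finType) (delta : O) (M : lts I delta)
    (A : set M) (p : M) :
  finite_set A ->
  (forall phi : formula I O, (forall q, A q -> sat q phi) -> sat p phi) ->
  exists2 q, A q & forall phi : formula I O, sat q phi -> sat p phi.
Proof.
(* [{classic M}] gives the states the equality test needed to list [A]. *)
move=> /(@finite_seqP {classic M}) [r ->] {A} /=.
elim: r => [|q r IHr] sat_p; first by case: (sat_p (FFalse I O)).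
have [q_le_p|] := pselect (forall phi : formula I O, sat q phi -> sat p phi).
  by exists q; rewrite //= inE eqxx.
move=> /existsNP [phi /not_implyP [q_phi p_nphi]].
have [psi r_psi|q' rq' q'_le_p] := IHr.
  have /= [|//|//] := sat_p (FOr phi psi).
  by move=> q'; rewrite /= inE => /predU1P[->|rq']; [left|right; exact: r_psi].
by exists q'; rewrite //= inE rq' orbT.
Qed.

(** A formula true at all [a]-successors of [q] makes a box formula true at [q], hence at [p], hence
    holds at [p']. For inputs, [ins q a] supplies the existence part of the box. *)
Lemma sat_le_iocos_relation (I O : finType) (delta : O) (M : lts I delta) :
  iocos_relation (fun p q : M =>
    forall phi : formula I O, sat q phi -> sat p phi).
Proof.
move=> p q q_le_p; split=> [a q_a|a p' q_a pp'|a p' pp'].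
- by have [] := q_le_p (FBoxIn a (FTrue I O)) (conj q_a (fun _ _ => Logic.I)).
- apply: finite_set_sat_le (image_finite q (inl a)) _ => phi q_phi.
  by have [_] := q_le_p (FBoxIn a phi) (conj q_a q_phi); apply.
- apply: finite_set_sat_le (image_finite q (inr a)) _ => phi q_phi.
  exact: q_le_p (FBoxOut a phi) q_phi _ pp'.
Qed.

Theorem theorem2 (I O : finType) (delta : O) (M : lts I delta) (i s : M) :
  iocos i s <-> (forall phi : formula I O, sat s phi -> sat i phi).
Proof.
split=> [i_iocos_s phi|s_le_i]; first exact: iocos_sat.
by eexists; [exact: sat_le_iocos_relation|].
Qed.
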